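(* Let $p$ satisfy hypothesis (H) on $(a,b)$, with $p_h(t,0)\neq0$ for all $t\in(a,b)$, $p_h(\cdot,0)$ continuous on $(a,b)$, and $1/p_h(\cdot,0)\in L^1(a,b)$. Let $F:[a,b]\to\mathbb{R}$ be continuous. If $F$ is $p$-differentiable on $(a,b)$ and $D_pF$ is continuous on $[a,b]$ (i.e. it extends continuously from $(a,b)$ to $[a,b]$), then $$I_p(D_pF)(b)=F(b)-F(a).$$
   Context: Here $p(t,h)$ is a real-valued function defined for $t\in(a,b)$ and $|h|<\delta$, where $\delta>0$ is generally unspecified (it may depend on $t$), with values in $[a,b]$, and $p_h=\partial p/\partial h$. A function $F:[a,b]\to\mathbb{R}$ is $p$-differentiable at $t\in(a,b)$ if $$D_pF(t)=\lim_{h\to0}\frac{F(p(t,h))-F(t)}{h}$$ exists and is finite. For continuous $f:[a,b]\to\mathbb{R}$, $$I_p(f)(t)=\int_a^t\frac{f(x)}{p_h(x,0)}\,dx,\qquad t\in[a,b].$$ Hypothesis (H) on $(a,b)$: for each $t\in(a,b)$, $p(t,h)$ and $p_h(t,h)$ exist and are continuous (in $h$) in a neighborhood of $h=0$; and for each $t\in(a,b)$, for each choice of sign and all sufficiently small $\varepsilon>0$, the equation $p(t,h)=t\pm\varepsilon$ has a solution $h=h(t,\varepsilon)$ such that $h\to0$ as $\varepsilon\to0$. *)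

(* Defs.v *)
From HB Require Import structures.
From mathcomp Require Import all_boot all_order all_algebra.
From mathcomp Require Import all_classical all_reals all_analysis.

Set Implicit Arguments.
Unset Strict Implicit.
Unset Printing Implicit Defensive.

Import Order.TTheory GRing.Theory Num.Theory.
Import numFieldNormedType.Exports.

Local Open Scope classical_set_scope.
Local Open Scope ring_scope.

Section PDerivative.
Variable R : realType.
Implicit Types (a b t h : R) (delta F f : R -> R) (p : R -> R -> R).

(* Functions on a subset of R are total here; p is only meaningful for t in
   ]a, b[ and |h| < delta t, and functions on [a, b] only there. *)
Definition p_domain a b delta p : Prop :=
  forall t, t \in `]a, b[ ->
    0 < delta t /\ forall h, `|h| < delta t -> p t h \in `[a, b].

Definition p_h p t h : R := derive1 (p t) h.

Definition p_quotient p F t h : R := (F (p t h) - F t) / h.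

Definition p_differentiable p F t : Prop :=
  cvg (p_quotient p F t h @[h --> 0^']).

Definition D_p p F t : R := lim (p_quotient p F t h @[h --> 0^']).

(* The open interval `]a, t[ keeps the integrand inside the domain of p_h;
   the endpoints are Lebesgue-null. *)
Definition I_p a p f t : R :=
  \int[@lebesgue_measure R]_(x in `]a, t[) (f x / p_h p x 0).

Definition p_h_regular p t : Prop :=
  \forall h \near (0 : R), [/\ derivable (p t) h 1,
    {for h, continuous (p t)} & {for h, continuous (p_h p t)}].

(* The sign is + for sg = false and - for sg = true. *)
Definition p_solvable delta p t (sg : bool) : Prop :=
  exists hs : R -> R,
    (\forall e \near 0^'+,
       `|hs e| < delta t /\ p t (hs e) = t + (-1) ^+ sg * e) /\
    hs e @[e --> 0^'+] --> (0 : R).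

Definition hypothesis_H a b delta p : Prop :=
  forall t, t \in `]a, b[ ->
    p_h_regular p t /\ forall sg : bool, p_solvable delta p t sg.

End PDerivative.

(* Main.v *)
Require Import Defs.
From HB Require Import structures.
From mathcomp Require Import all_boot all_order all_algebra.
From mathcomp Require Import all_classical all_reals all_analysis.
From mathcomp Require Import measurable_realfun ring.

Set Implicit Arguments.
Unset Strict Implicit.
Unset Printing Implicit Defensive.

Import Order.TTheory GRing.Theory Num.Theory.
Import numFieldNormedType.Exports.

Local Open Scope classical_set_scope.
Local Open Scope ring_scope.

(** The hypotheses reduce the theorem to ordinary calculus. The solutions
    [h = h(t, e)] of [p t h = t +- e] tend to [0] with [e], so continuity of
    [p t] forces [p t 0 = t] ([p_solvable_at0]). The ordinary difference
    quotient of [F] at [t] with increment [+- e] can then be factored as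
<<
      F(p(t,h)) - F(t)     / p(t,h) - p(t,0)
      ----------------    /  ---------------     at  h = h(t, e),
             h           /          h
>>
    and the two factors tend to [D_p F t] and [p_h t 0 != 0]. Hence [F] is
    differentiable in the usual sense, with [F' = D_p F / p_h(., 0)] on
    [(a, b)] ([is_derive_of_p_differentiable]); this is exactly the integrand
    of [I_p (D_p F)].

    It remains to integrate [F'] over [(a, b)]. It is continuous there, but
    need not be bounded near the endpoints, so the version of the fundamental
    theorem needed is the one for an integrable continuous derivative on the
    open interval and a continuous primitive on the closed one
    ([FTC2_open_itv]). Integrability holds because [1 / p_h(., 0)] is
    integrable and the extension of [D_p F] to the compact [[a, b]] is
    bounded. *)

Section ImproperFTC.
Variable R : realType.
Notation mu := (@lebesgue_measure R).
Implicit Types (a b : R) (f F : R -> R).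

Lemma integrable_itv_oo_cc a b f :
  mu.-integrable `]a, b[ (EFin \o f) -> mu.-integrable `[a, b] (EFin \o f).
Proof.
move=> /integrableP[mf foo].
have mfc := emeasurable_fun_itv_cc mf.
apply/integrableP; split=> //.
have mabs : measurable_fun `[a, b] (fun x => `|(f x)%:E|%E).
  exact: (measurableT_comp _ mfc).
rewrite -integral_itv_bndo_bndc; last first.
  by apply: measurable_funS mabs => //; exact: subset_itv_co_cc.
rewrite -integral_itv_obnd_cbnd //.
by apply: measurable_funS mabs => //; exact: subset_itv_oo_cc.
Qed.

(** The primitive [G x] of [f] is continuous up to the endpoints by absolute
    continuity of the integral, so [F - G] is continuous on [[a, b]] with zero
    derivative inside: a single use of the mean value theorem on all of
    [[a, b]] replaces a limit of integrals over inner subintervals. *)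
Lemma FTC2_open_itv a b f F : a < b ->
  {within `[a, b], continuous F} ->
  (forall x, x \in `]a, b[ -> is_derive x 1 F (f x)) ->
  {in `]a, b[, continuous f} ->
  mu.-integrable `]a, b[ (EFin \o f) ->
  \int[mu]_(x in `]a, b[) f x = F b - F a.
Proof.
move=> ab cF dF cf intf; have intfc := integrable_itv_oo_cc intf.
pose G x := parameterized_integral mu a x f.
have cG : {within `[a, b], continuous G}.
  exact: (parameterized_integral_continuous (ltW ab) intfc).
have dFG x : x \in `]a, b[ -> is_derive x 1 (F - G) (cst 0 x).
  move=> xab; have [ax xb] : a < x /\ x < b by split; rewrite (itvP xab).
  have [derG G'f] := continuous_FTC1_closed xb intfc ax (cf _ xab).
  have dGx : is_derive x 1 G (f x) by apply: DeriveDef; rewrite // -derive1E.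
  have := dF _ xab => dFx; apply: is_derive_eq; exact: subrr.
have [c _] := MVT ab dFG (within_continuousB cF cG).
rewrite mul0r => /eqP; rewrite subr_eq0 => /eqP.
rewrite -[_ b]/(F b - G b) -[_ a]/(F a - G a) => FGab.
have Ga : G a = 0.
  by rewrite /G /parameterized_integral set_itv1 Rintegral_set1.
have Gb : G b = F b - F a.
  by move: FGab; rewrite Ga subr0 => <-; rewrite subKr.
rewrite -Gb /G /parameterized_integral.
rewrite -Rintegral_itv_obnd_cbnd; last first.
  by apply: integrableS intfc => //; exact: subset_itv_oc_cc.
by rewrite -Rintegral_itv_bndo_bndc.
Qed.

End ImproperFTC.

Section PChainRule.
Variable R : realType.
Implicit Types (a b t h : R) (delta F : R -> R) (p : R -> R -> R).

(** Both [p t 0] and [t] are limits of [p t (hs e) = t +- e] as [e] tends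
    to [0]. *)
Lemma p_solvable_at0 delta p t sg :
  p_h_regular p t -> p_solvable delta p t sg -> p t 0 = t.
Proof.
move=> /nbhs_singleton[_ cp _] [hs [solved hs0]].
have lim1 : p t (hs e) @[e --> 0^'+] --> p t 0 by exact: cvg_comp hs0 cp.
have lim2 : p t (hs e) @[e --> 0^'+] --> t.
  apply: (@cvg_trans _ ((fun e : R => t + (-1) ^+ sg * e) @ 0^'+)).
    by apply: near_eq_cvg; apply: filterS solved => e [].
  have {2}-> : t = t + (-1) ^+ sg * 0 by rewrite mulr0 addr0.
  apply: cvgD; first exact: cvg_cst.
  apply: cvgM; first exact: cvg_cst.
  exact: cvg_within.
exact: cvg_unique lim1 lim2.
Unshelve. all: by end_near. Qed.

(** The increment [+- e] of [t] is realized as [p t h - p t 0] with [h = hs e],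
    which turns the slope of [F] into the [p]-quotient of [F] divided by the
    slope of [p t] at [0]. *)
Lemma cvg_slope_p_solvable delta p F t sg :
  p_h_regular p t -> p_solvable delta p t sg -> p_h p t 0 != 0 ->
  p_differentiable p F t ->
  (F (t + (-1) ^+ sg * e) - F t) / ((-1) ^+ sg * e) @[e --> 0^'+]
    --> D_p p F t / p_h p t 0.
Proof.
move=> reg sol ph0 pF; have pt0 := p_solvable_at0 reg sol.
case: sol => hs [solved hs0].
(* Otherwise [t +- e = p t 0 = t]. *)
have hs_neq0 : \forall e \near 0^'+, hs e != 0.
  near=> e; have e0 : 0 < e by [].
  have pe : p t (hs e) = t + (-1) ^+ sg * e.
    by near: e; apply: filterS solved => e [].
  apply/eqP => he; move: pe; rewrite he pt0 -[LHS]addr0 => /addrI/esym/eqP.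
  by rewrite mulf_eq0 signr_eq0 /= gt_eqF.
(* [D_p] and [p_h] are limits at the punctured neighbourhood of [0]. *)
have hs0' : hs e @[e --> 0^'+] --> 0^'.
  move=> A [r /= r0 Ar]; near=> e; apply: Ar; last by near: e.
  by near: e; move/cvgrPdist_lt : hs0; apply.
have limF : p_quotient p F t (hs e) @[e --> 0^'+] --> D_p p F t.
  exact: cvg_comp hs0' pF.
have dp : (p t h - p t 0) / h @[h --> 0^'] --> p_h p t 0.
  have [derp _ _] := nbhs_singleton reg.
  rewrite /p_h derive1E; apply: cvg_trans derp; apply: near_eq_cvg.
  by apply: nearW => h /=; rewrite [_%:A]mulr1 addr0 [RHS]mulrC.
have limp : (p t (hs e) - p t 0) / hs e @[e --> 0^'+] --> p_h p t 0.
  exact: cvg_comp hs0' dp.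
apply: cvg_trans (cvgM limF (cvgV ph0 limp)).
apply: near_eq_cvg; near=> e.
have pe : p t (hs e) = t + (-1) ^+ sg * e.
  by near: e; apply: filterS solved => e [].
have hse : hs e != 0 by near: e.
have e0 : e != 0 by rewrite gt_eqF.
rewrite /= /p_quotient pt0 pe [t + _ - t]addrAC subrr add0r.
by field; rewrite hse e0 signr_eq0.
Unshelve. all: by end_near. Qed.

(** The two signs in the solvability hypothesis give the right and the left
    derivatives of [F], with a common value. *)
Lemma is_derive_of_p_differentiable delta p F t :
  p_h_regular p t -> (forall sg, p_solvable delta p t sg) ->
  p_h p t 0 != 0 -> p_differentiable p F t ->
  is_derive t 1 F (D_p p F t / p_h p t 0).
Proof.
move=> reg sol ph0 pF; set l := _ / _.
have slope sg := cvg_slope_p_solvable reg (sol sg) ph0 pF.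
have slopeF : h^-1 *: (F (h + t) - F t) @[h --> 0^'] --> l.
  apply: (@cvg_at_right_left_dnbhs _ R^o).
    apply: cvg_trans (slope false); apply: near_eq_cvg; apply: nearW => e.
    by rewrite expr0 mul1r [t + e]addrC mulrC.
  have -> : (0 : R)^'- = -%R @ 0^'+ by rewrite -at_leftN oppr0.
  rewrite -fmap_comp.
  apply: cvg_trans (slope true); apply: near_eq_cvg; apply: nearW => e.
  by rewrite /= expr1 mulN1r [t - e]addrC mulrC.
have F1l : derive1 F t = l by exact/cvg_lim.
apply: DeriveDef; last by rewrite -derive1E.
apply/cvg_ex; exists l; apply: cvg_trans slopeF; apply: near_eq_cvg.
by apply: nearW => h /=; rewrite [_%:A]mulr1.
Qed.

End PChainRule.

Theorem theorem4p4 (R : realType) (a b : R) (delta : R -> R)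
  (p : R -> R -> R) (F DF : R -> R)
  (ab : a < b)
  (p_dom : p_domain a b delta p)
  (p_H : hypothesis_H a b delta p)
  (p_h_neq0 : forall t : R, t \in `]a, b[ -> p_h p t 0 != 0)
  (p_h_cont : {within `]a, b[, continuous (fun t : R => p_h p t 0)})
  (p_h_L1 : (@lebesgue_measure R).-integrable `]a, b[
              (fun t : R => ((p_h p t 0)^-1)%:E))
  (F_cont : {within `[a, b], continuous F})
  (F_pdiff : forall t : R, t \in `]a, b[ -> p_differentiable p F t)
  (DF_cont : {within `[a, b], continuous DF})
  (DF_ext : forall t : R, t \in `]a, b[ -> DF t = D_p p F t) :
  I_p a p DF b = F b - F a.
Proof.
have dF t : t \in `]a, b[ -> is_derive t 1 F (DF t / p_h p t 0).
  move=> tab; have [reg sol] := p_H _ tab; rewrite DF_ext //.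
  exact: is_derive_of_p_differentiable reg sol (p_h_neq0 _ tab) (F_pdiff _ tab).
have cDF : {in `]a, b[, continuous DF}.
  by have /(continuous_within_itvP _ ab)[] := DF_cont.
have cph : {in `]a, b[, continuous (fun t => p_h p t 0)}.
  move: p_h_cont; rewrite continuous_open_subspace; last exact: interval_open.
  by move=> c t tab; apply: c; rewrite inE.
apply: FTC2_open_itv => //.
  move=> t tab; apply: cvgM; first exact: cDF.
  exact: cvgV (p_h_neq0 _ tab) (cph _ tab).
have bDF : [bounded DF x | x in `]a, b[%classic].
  have [M [Mreal MDF]] :=
    compact_bounded (continuous_compact DF_cont (@segment_compact _ a b)).
  exists M; split=> // x Mx y /= yab; apply: (MDF _ Mx) => /=; exists y => //.
  exact: subset_itv_oo_cc yab.
apply: (@integrableMr _ _ _ (@lebesgue_measure R) _ _ DF _ _ bDF p_h_L1) => //.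
apply: open_continuous_measurable_fun; first exact: interval_open.
by move=> t; rewrite inE => /cDF.
Qed.
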